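(* Let $\gamma > 0$ be a real number, and let $e$ denote Euler's number. For real $r \ge 0$ define $$p(r) = \log_2\left(1 + \frac{e}{2\pi}\,\frac{r\gamma}{r+\gamma+1}\right) + \log_2\left(1 + \frac{e}{2\pi}\,\frac{r\gamma}{r+1}\right),$$ $$q(r) = \frac{1}{2}\log_2\left(1 + \frac{e}{2\pi}\gamma\right) + \frac{1}{2}\log_2\left(1 + \frac{e}{2\pi} r\gamma\right),$$ and $f(r) = p(r) - q(r)$. Then the equation $f(r) = 0$ has at most two positive solutions; and, writing $r_{\min} \le r_{\max}$ for these solutions (with $r_{\min} = r_{\max}$ if there is exactly one), whenever they exist, one has $f(r) \ge 0$ for all $r \in [r_{\min}, r_{\max}]$.
   Context: Here $\gamma$ is the signal-to-noise ratio of the weaker of two users and $r$ is the squared ratio of the stronger to the weaker user's channel gain. The quantities $p(r)$ and $q(r)$ are, up to a common time-slot factor, the two users' achievable sum-rates under non-orthogonal multiple access and under equal-time time-division multiple access, respectively. This interpretation is not needed for the claim, which is purely about the explicit real functions defined in it. *)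

(* Defs.v *)
From Stdlib Require Import Reals.
Open Scope R_scope.

Definition log2 (x : R) : R := ln x / ln 2.

Definition c0 : R := exp 1 / (2 * PI).

(* For gamma > 0 and r >= 0 every denominator below is positive and every
   argument of log2 is at least 1, so the totalized "/" and "ln" never take
   their default values on the intended domain. *)
Definition p_fun (gamma r : R) : R :=
  log2 (1 + c0 * (r * gamma / (r + gamma + 1)))
  + log2 (1 + c0 * (r * gamma / (r + 1))).

Definition q_fun (gamma r : R) : R :=
  1 / 2 * log2 (1 + c0 * gamma) + 1 / 2 * log2 (1 + c0 * r * gamma).

Definition f_fun (gamma r : R) : R := p_fun gamma r - q_fun gamma r.

Definition positive_solution (gamma r : R) : Prop := 0 < r /\ f_fun gamma r = 0.

(* Main.v *)
(** Clearing logarithms and denominators, [f_fun gamma r] has the sign of a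
    quintic in [r] whose coefficients of degree 0, 1 and 5 are negative, and
    whose coefficients of degree 2 and 4 are never both positive because
    [c0 < 1/2].  Its coefficients thus change sign at most twice, and, as in
    Descartes' rule of signs, such a polynomial is positive strictly between
    any two of its positive roots. *)

Require Import Defs.
From Stdlib Require Import Reals Lra Lia.
Open Scope R_scope.

(** With [d = j - i], [U = u * a ^ i] and [V = v * b ^ i], the equations read [U + V = 1] and
    [U * a ^ d + V * b ^ d = 1]. So [U], [V] are the barycentric coordinates of 1 between
    [a ^ d < 1] and [b ^ d > 1], hence positive. *)
Lemma pow_combination_exists (a b : R) (i j : nat) :
  0 < a < 1 -> 1 < b -> (i < j)%nat ->
  exists u v : R, 0 < u /\ 0 < v /\
    u * a ^ i + v * b ^ i = 1 /\ u * a ^ j + v * b ^ j = 1.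
Proof.
  intros [a0 a1] b1 ij.
  replace j with (i + S (j - i - 1))%nat by lia.
  generalize (j - i - 1)%nat; intro n.
  assert (ai : 0 < a ^ i) by (apply pow_lt; lra).
  assert (bi : 0 < b ^ i) by (apply pow_lt; lra).
  assert (an : a ^ S n < 1) by (apply pow_lt_1_compat; [lra | lia]).
  assert (bn : 1 < b ^ S n) by (apply Rlt_pow_R1; [lra | lia]).
  exists ((b ^ S n - 1) / (a ^ i * (b ^ S n - a ^ S n))).
  exists ((1 - a ^ S n) / (b ^ i * (b ^ S n - a ^ S n))).
  rewrite !pow_add.
  split; [| split; [| split]].
  - apply Rdiv_lt_0_compat; [lra | apply Rmult_lt_0_compat; lra].
  - apply Rdiv_lt_0_compat; [lra | apply Rmult_lt_0_compat; lra].
  - set (A := a ^ S n) in *; set (B := b ^ S n) in *; field; lra.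
  - set (A := a ^ S n) in *; set (B := b ^ S n) in *; field; lra.
Qed.

(** The second difference of [a ^ i] is [a ^ i * (1 - a) ^ 2], positive since [a] differs from 1;
    likewise for [b]. *)
Lemma pow_combination_convex (a b u v : R) (i : nat) :
  0 < a < 1 -> 1 < b -> 0 < u -> 0 < v ->
  2 * (u * a ^ S i + v * b ^ S i)
  < (u * a ^ i + v * b ^ i) + (u * a ^ S (S i) + v * b ^ S (S i)).
Proof.
  intros [a0 a1] b1 u0 v0; simpl.
  assert (0 < u * a ^ i * ((1 - a) * (1 - a))).
  { repeat apply Rmult_lt_0_compat; try apply pow_lt; lra. }
  assert (0 < v * b ^ i * ((b - 1) * (b - 1))).
  { repeat apply Rmult_lt_0_compat; try apply pow_lt; lra. }
  nra.
Qed.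

Definition quintic (k0 k1 k2 k3 k4 k5 x : R) : R :=
  k0 + k1 * x + k2 * x ^ 2 + k3 * x ^ 3 + k4 * x ^ 4 + k5 * x ^ 5.

(* The weights [w i = u a^i + v b^i] are strictly convex in [i].  Normalizing
   them to be 1 at the two exponents where the coefficients change sign makes
   every [k_i (1 - w i)] nonnegative, and these sum to [F 1 - u F a - v F b]. *)
Lemma quintic_pos_at_1 (k0 k1 k2 k3 k4 k5 a b : R) :
  k0 < 0 -> k1 <= 0 -> k5 < 0 -> k4 <= 0 \/ k2 <= 0 ->
  0 < a < 1 -> 1 < b ->
  0 <= quintic k0 k1 k2 k3 k4 k5 a -> 0 <= quintic k0 k1 k2 k3 k4 k5 b ->
  0 < quintic k0 k1 k2 k3 k4 k5 1.
Proof.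
  intros h0 h1 h5 h42 Ha Hb Fa Fb.
  assert (by_weights : forall i j : nat, (i < j)%nat ->
    (forall w : nat -> R, w i = 1 -> w j = 1 ->
       (forall n, 2 * w (S n) < w n + w (S (S n))) ->
       0 < k0 * (1 - w 0%nat) + k1 * (1 - w 1%nat) + k2 * (1 - w 2%nat)
           + k3 * (1 - w 3%nat) + k4 * (1 - w 4%nat) + k5 * (1 - w 5%nat)) ->
    0 < quintic k0 k1 k2 k3 k4 k5 1).
  { intros i j ij H.
    destruct (pow_combination_exists a b i j Ha Hb ij)
      as (u & v & u0 & v0 & wi & wj).
    specialize (H (fun n => u * a ^ n + v * b ^ n) wi wj
      (fun n => pow_combination_convex a b u v n Ha Hb u0 v0)).
    cbv beta in H.
    pose proof (Rmult_le_pos _ _ (Rlt_le _ _ u0) Fa) as uFa.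
    pose proof (Rmult_le_pos _ _ (Rlt_le _ _ v0) Fb) as vFb.
    unfold quintic in *; ring_simplify in H; ring_simplify in uFa;
      ring_simplify in vFb; lra. }
  assert (exponents : exists i j : nat, (i < j)%nat /\
    forall w : nat -> R, w i = 1 -> w j = 1 ->
       (forall n, 2 * w (S n) < w n + w (S (S n))) ->
       1 < w 0%nat /\ 1 <= w 5%nat /\ 1 <= w 1%nat /\
       0 <= k2 * (1 - w 2%nat) /\ 0 <= k3 * (1 - w 3%nat) /\
       0 <= k4 * (1 - w 4%nat)).
  (* These are the sign patterns left by [h42]. In each, [i] and [j] enclose exactly the exponents
     among 2, 3, 4 whose coefficient is taken as nonnegative, except that those at [i] or [j]
     contribute 0. By convexity [w <= 1] between [i] and [j] and [w >= 1] outside; always [1 <= i]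
     and [j <= 5]. *)
  { assert (cases : k4 <= 0 /\ 0 <= k3 /\ 0 <= k2 \/ k4 <= 0 /\ 0 <= k3 /\ k2 <= 0
      \/ k4 <= 0 /\ k3 <= 0 /\ 0 <= k2 \/ k4 <= 0 /\ k3 <= 0 /\ k2 <= 0
      \/ 0 <= k4 /\ 0 <= k3 /\ k2 <= 0 \/ 0 <= k4 /\ k3 <= 0 /\ k2 <= 0) by lra.
    destruct cases as [c | [c | [c | [c | [c | c]]]]];
      [ exists 1%nat, 4%nat | exists 2%nat, 4%nat | exists 1%nat, 3%nat
      | exists 2%nat, 3%nat | exists 2%nat, 5%nat | exists 3%nat, 5%nat ];
      (split; [lia |]; intros w wi wj cvx;
       pose proof (cvx 0%nat); pose proof (cvx 1%nat);
       pose proof (cvx 2%nat); pose proof (cvx 3%nat); clear cvx;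
       repeat split; try lra; destruct c as (c4 & c3 & c2);
       match goal with |- 0 <= _ * (1 - ?x) =>
         first [ assert (x <= 1) by lra; nra | assert (1 <= x) by lra; nra ]
       end). }
  destruct exponents as (i & j & ij & H).
  apply (by_weights i j ij); intros w wi wj cvx.
  destruct (H w wi wj cvx) as (w0 & w5 & w1 & H2 & H3 & H4).
  (* Strictness of the whole sum comes from this term: [k0 < 0] and, as [0 < i], [w 0 > 1]. *)
  assert (0 < k0 * (1 - w 0%nat)) by nra.
  assert (0 <= k1 * (1 - w 1%nat)) by nra.
  assert (0 <= k5 * (1 - w 5%nat)) by nra.
  lra.
Qed.

(** Dilating the variable by [y] moves the middle point to 1 and multiplies each coefficient by a
    positive power of [y], which preserves the sign pattern. *)
Lemma quintic_pos_between (k0 k1 k2 k3 k4 k5 x y z : R) :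
  k0 < 0 -> k1 <= 0 -> k5 < 0 -> k4 <= 0 \/ k2 <= 0 ->
  0 < x < y -> y < z ->
  0 <= quintic k0 k1 k2 k3 k4 k5 x -> 0 <= quintic k0 k1 k2 k3 k4 k5 z ->
  0 < quintic k0 k1 k2 k3 k4 k5 y.
Proof.
  intros h0 h1 h5 h42 [x0 xy] yz Px Pz.
  assert (y0 : 0 < y) by lra.
  assert (scale : forall t,
    quintic k0 (k1 * y) (k2 * y ^ 2) (k3 * y ^ 3) (k4 * y ^ 4) (k5 * y ^ 5) (t / y)
    = quintic k0 k1 k2 k3 k4 k5 t).
  { intro t; unfold quintic; field; lra. }
  rewrite <- scale in *.
  replace (y / y) with 1 by (field; lra).
  pose proof (pow_lt y 2 y0); pose proof (pow_lt y 4 y0); pose proof (pow_lt y 5 y0).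
  apply quintic_pos_at_1 with (a := x / y) (b := z / y); try assumption.
  - nra.
  - nra.
  - destruct h42; [left | right]; nra.
  - split; [apply Rdiv_lt_0_compat; lra |].
    apply Rmult_lt_reg_r with y; [lra |]; field_simplify; lra.
  - apply Rmult_lt_reg_r with y; [lra |]; field_simplify; lra.
Qed.

(** The upper bound amounts to [exp 1 <= 3 < PI]. *)
Lemma c0_bounds : 0 < c0 < 1 / 2.
Proof.
  unfold c0.
  pose proof (exp_pos 1); pose proof exp_le_3; pose proof PI2_3_2; unfold PI2 in *.
  split; [apply Rdiv_lt_0_compat; lra |].
  apply Rmult_lt_reg_r with (2 * PI); [lra |]; field_simplify; lra.
Qed.

Lemma ln_div (x y : R) : 0 < x -> 0 < y -> ln (x / y) = ln x - ln y.
Proof.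
  intros x0 y0; unfold Rdiv.
  rewrite ln_mult, ln_Rinv; [ring | assumption | assumption |].
  now apply Rinv_0_lt_compat.
Qed.

(** The quotient [f_num / f_den] is 4 to the power [f_fun]: doubling [f_fun] removes the factors 1/2
    of [q_fun] and squares the arguments of the logarithms in [p_fun]. *)
Definition f_num (gamma r : R) : R :=
  ((1 + c0 * gamma) * r + gamma + 1) ^ 2 * ((1 + c0 * gamma) * r + 1) ^ 2.

Definition f_den (gamma r : R) : R :=
  (1 + c0 * gamma) * (1 + c0 * r * gamma) * (r + gamma + 1) ^ 2 * (r + 1) ^ 2.

Lemma f_num_pos (gamma r : R) : 0 < gamma -> 0 < r -> 0 < f_num gamma r.
Proof.
  intros g0 r0; destruct c0_bounds as [c_pos _]; unfold f_num.
  assert (0 < c0 * gamma) by nra.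
  apply Rmult_lt_0_compat; apply pow_lt; nra.
Qed.

Lemma f_den_pos (gamma r : R) : 0 < gamma -> 0 < r -> 0 < f_den gamma r.
Proof.
  intros g0 r0; destruct c0_bounds as [c_pos _]; unfold f_den.
  assert (0 < c0 * gamma) by nra.
  assert (0 < c0 * r) by nra.
  repeat apply Rmult_lt_0_compat; try apply pow_lt; nra.
Qed.

Lemma f_fun_ln (gamma r : R) : 0 < gamma -> 0 < r ->
  f_fun gamma r = (ln (f_num gamma r) - ln (f_den gamma r)) / (2 * ln 2).
Proof.
  intros g0 r0; destruct c0_bounds as [c_pos _].
  assert (cg : 0 < c0 * gamma) by nra.
  assert (crg : 0 < c0 * r * gamma) by nra.
  assert (ln2 : 0 < ln 2) by (pose proof ln_lt_2; lra).
  unfold f_fun, p_fun, q_fun, log2, f_num, f_den.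
  replace (1 + c0 * (r * gamma / (r + gamma + 1)))
    with (((1 + c0 * gamma) * r + gamma + 1) / (r + gamma + 1)) by (field; lra).
  replace (1 + c0 * (r * gamma / (r + 1)))
    with (((1 + c0 * gamma) * r + 1) / (r + 1)) by (field; lra).
  assert (0 < (1 + c0 * gamma) * r) by nra.
  assert (0 < (1 + c0 * gamma) * (1 + c0 * r * gamma)) by nra.
  assert (sq : forall t, 0 < t -> 0 < t ^ 2) by (intros; apply pow_lt; assumption).
  assert (0 < (1 + c0 * gamma) * (1 + c0 * r * gamma) * (r + gamma + 1) ^ 2)
    by (apply Rmult_lt_0_compat; [assumption | apply sq; lra]).
  rewrite !ln_div by lra.
  rewrite !ln_mult by (try apply sq; lra).
  rewrite !ln_pow by lra.
  simpl INR; field; lra.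
Qed.

Lemma f_fun_pos_iff (gamma r : R) : 0 < gamma -> 0 < r ->
  0 < f_fun gamma r <-> 0 < f_num gamma r - f_den gamma r.
Proof.
  intros g0 r0.
  pose proof (f_num_pos gamma r g0 r0); pose proof (f_den_pos gamma r g0 r0).
  assert (ln2 : 0 < ln 2) by (pose proof ln_lt_2; lra).
  rewrite f_fun_ln by assumption.
  assert (i2 : 0 < / (2 * ln 2)) by (apply Rinv_0_lt_compat; lra).
  unfold Rdiv; split; intro h.
  - assert (ln (f_den gamma r) < ln (f_num gamma r)) by nra.
    assert (f_den gamma r < f_num gamma r) by (apply ln_lt_inv; assumption).
    lra.
  - assert (ln (f_den gamma r) < ln (f_num gamma r)) by (apply ln_increasing; lra).
    apply Rmult_lt_0_compat; lra.
Qed.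

Lemma f_fun_zero_num_den (gamma r : R) : 0 < gamma -> 0 < r ->
  f_fun gamma r = 0 -> f_num gamma r = f_den gamma r.
Proof.
  intros g0 r0 f0.
  pose proof (f_num_pos gamma r g0 r0); pose proof (f_den_pos gamma r g0 r0).
  assert (ln2 : 0 < ln 2) by (pose proof ln_lt_2; lra).
  rewrite f_fun_ln in f0 by assumption.
  apply ln_inv; try assumption.
  apply Rmult_integral in f0; destruct f0 as [f0 | f0]; [lra |].
  assert (0 < / (2 * ln 2)) by (apply Rinv_0_lt_compat; lra).
  lra.
Qed.

(** The factor [c0 * gamma] splits off because numerator and denominator coincide as polynomials
    when [c0] or [gamma] is set to 0. Degree 5 in [r] comes from [f_den] alone. *)
Lemma f_num_den_quintic (gamma r : R) :
  f_num gamma r - f_den gamma r = c0 * gamma *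
    quintic (- (gamma + 1) ^ 2)
      (- (1 + c0 * gamma) * (gamma + 1) ^ 2)
      ((1 + c0 * gamma) * (2 - gamma ^ 2))
      ((1 + c0 * gamma) * (2 + (4 * c0 - 2) * gamma + (2 * c0 - 1) * gamma ^ 2))
      ((1 + c0 * gamma) * (c0 ^ 2 * gamma ^ 2 + (3 * c0 - 2) * gamma - 1))
      (- (1 + c0 * gamma)) r.
Proof. unfold f_num, f_den, quintic; ring. Qed.

(** Strict positivity serves both halves of the theorem: it excludes a third solution between two
    others and gives the sign inside the interval. *)
Lemma f_fun_pos_between (gamma x y z : R) :
  0 < gamma -> positive_solution gamma x -> positive_solution gamma z ->
  x < y < z -> 0 < f_fun gamma y.
Proof.
  intros g0 [x0 fx] [z0 fz] [xy yz]; destruct c0_bounds as [c_pos c_half].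
  apply f_fun_pos_iff; [lra | lra |].
  apply f_fun_zero_num_den in fx; [| lra | lra].
  apply f_fun_zero_num_den in fz; [| lra | lra].
  apply Rminus_diag_eq in fx; apply Rminus_diag_eq in fz.
  rewrite f_num_den_quintic in *.
  assert (cg : 0 < c0 * gamma) by nra.
  apply Rmult_integral in fx; destruct fx as [fx | fx]; [lra |].
  apply Rmult_integral in fz; destruct fz as [fz | fz]; [lra |].
  apply Rmult_lt_0_compat; [assumption |].
  apply quintic_pos_between with (x := x) (z := z); try lra.
  - nra.
  - nra.
  (* If [gamma ^ 2 >= 2], the factor [2 - gamma ^ 2] settles degree 2. Otherwise [c0 < 1/2] gives
     [c0 ^ 2 * gamma ^ 2 < 1/2] and [3 * c0 - 2 < 0], so the coefficient of degree 4 is negative. *)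
  - destruct (Rle_lt_dec 2 (gamma ^ 2)) as [large | small]; [right; nra | left].
    assert (c0 ^ 2 * gamma ^ 2 + (3 * c0 - 2) * gamma - 1 <= 0); [| nra].
    assert (c0 ^ 2 <= 1 / 4) by nra.
    assert (c0 ^ 2 * gamma ^ 2 <= 1 / 4 * gamma ^ 2) by nra.
    nra.
Qed.

Theorem proposition1 :
  forall gamma : R, 0 < gamma ->
    (forall r1 r2 r3 : R,
        positive_solution gamma r1 ->
        positive_solution gamma r2 ->
        positive_solution gamma r3 ->
        r1 = r2 \/ r1 = r3 \/ r2 = r3)
    /\
    (forall rmin rmax : R,
        positive_solution gamma rmin ->
        positive_solution gamma rmax ->
        (forall s : R, positive_solution gamma s -> rmin <= s <= rmax) ->
        forall r : R, rmin <= r <= rmax -> 0 <= f_fun gamma r).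
Proof.
  intros gamma g0; split.
  - assert (no_three : forall x y z, positive_solution gamma x ->
      positive_solution gamma y -> positive_solution gamma z -> ~ x < y < z).
    { intros x y z sx [_ fy] sz xyz.
      pose proof (f_fun_pos_between gamma x y z g0 sx sz xyz); lra. }
    intros r1 r2 r3 s1 s2 s3.
    (* Three pairwise distinct reals have one strictly between the other two; cyclic orders are
       contradictory and fall to [lra]. *)
    destruct (Rtotal_order r1 r2) as [h12 | [h12 | h12]];
      destruct (Rtotal_order r1 r3) as [h13 | [h13 | h13]];
      destruct (Rtotal_order r2 r3) as [h23 | [h23 | h23]]; auto; exfalso;
      first [ lra
            | now apply (no_three r1 r2 r3) | now apply (no_three r1 r3 r2)
            | now apply (no_three r2 r1 r3) | now apply (no_three r2 r3 r1)
            | now apply (no_three r3 r1 r2) | now apply (no_three r3 r2 r1) ].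
  - intros rmin rmax smin smax _ r [[lo | <-] [hi | ->]].
    + apply Rlt_le, f_fun_pos_between with rmin rmax; auto.
    + destruct smax; lra.
    + destruct smin; lra.
    + destruct smax; lra.
Qed.
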